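(* Let $\mathcal C$ be a deployment contract with declared scope $\Sigma$, let $p$ be a deployed predicate on $\Sigma$, and assume that the contractually specified negative side of $p$, written $\lnot p$, is refutation-sound for $p$ on $\Sigma$. Let $\mathcal I_{\mathcal C}$, $\mathcal I_{\mathcal C}(x)=\langle v_x,\mathrm{trace}_x\rangle$, be an interface that is binary-total and certificate-sound for $p$ on $\Sigma$, relative to $\mathcal C$. Then $\mathcal I_{\mathcal C}$ yields a witnessed decision procedure for $p$ on $\Sigma$, that is, a terminating procedure which, for every $x\in\Sigma$, returns one of the two sides ($p(x)$ or $\lnot p(x)$) together with an adequate forcing certificate for that side.
   Context: A deployment contract is a tuple $\mathcal C=\langle \Sigma,R,t_{\mathrm{int}},B_{\mathrm{budget}},N_{\max};S,\tau,t\rangle$, where $\Sigma$ is the set of admissible inputs (declared scope), $\langle R,t_{\mathrm{int}}\rangle$ is an internal certification regime and configuration time, $B_{\mathrm{budget}}$ is a resource budget, $N_{\max}$ is a refinement horizon, and $\langle S,\tau,t\rangle$ is a public evidential standard, threshold specification and record-time. For the statement, these parameters matter only through the following data fixed by $\mathcal C$. Certificates. Certificates $\kappa$ are finite structured objects. The contract fixes an adequacy condition $\mathrm{Adeq}_{\mathcal C}(\kappa,x)$ (the certificate passes the contract's checks, including budget and horizon compliance, and applies to the case $x$) and forcing relations $\kappa\Vdash_{\mathcal C}p(x)$ and $\kappa\Vdash_{\mathcal C}\lnot p(x)$, meaning that the witness component of $\kappa$ settles the deployed predicate $p(x)$, respectively its contractually specified negative side, under the regime declared by $\mathcal C$. The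 negative side is a specified condition, not the mere failure to force $p(x)$. An adequate forcing certificate for a side at $x$ is a $\kappa$ with $\mathrm{Adeq}_{\mathcal C}(\kappa,x)$ that forces that side. Refutation-soundness. The contractually specified negative side is refutation-sound for $p$ on $\Sigma$ if, for every $x\in\Sigma$, whenever an adequate certificate forces that side, it constructively establishes $\lnot p(x)$ (the negation of $p(x)$). The notation $\lnot p(x)$ for the negative side is reserved for a negative side satisfying this condition. Interfaces. An interface assigns to each input $x$ a pair $\mathcal I_{\mathcal C}(x)=\langle v_x,\mathrm{trace}_x\rangle$, with a status $v_x\in\{A,D,U\}$ (Asserted, Denied, Undetermined) and a trace $\mathrm{trace}_x$, a record of the certificates, checks and reason payloads produced under $\mathcal C$; $\kappa\in\mathrm{trace}_x$ means that $\kappa$ occurs among the certificates in the trace. Operational assumptions. $\mathrm{trace}_x$ is finite and effectively enumerable, and the adequacy and forcing checks are decidable under $\mathcal C$. Output contract. Put $A_x\equiv\exists\kappa\in\mathrm{trace}_x\,(\mathrm{Adeq}_{\mathcal C}(\kappa,x)\land\kappa\Vdash_{\mathcal C}p(x))$ and $D_x\equiv\exists\kappa\in\mathrm{trace}_x\,(\mathrm{Adeq}_{\mathcal C}(\kappa,x)\land\kappa\Vdash_{\mathcal C}\lnot p(x))$. The output contract requires $v_x=A$ if $A_x\land\lnot D_x$; $v_x=D$ if $D_x\land\lnot A_x$; $v_x=U$ if $\lnot A_x\land\lnot D_x$; and $v_x=U$ if $A_x\land D_x$. Binary totality. $\mathcal I_{\mathcal C}$ is binary-total for $p$ on $\Sigma$,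 relative to $\mathcal C$, if for every $x\in\Sigma$ the contract-level evaluation of $\mathcal I_{\mathcal C}(x)$ terminates within the resources and refinement horizon fixed by $\mathcal C$ and returns $v_x\in\{A,D\}$. Certificate soundness. $\mathcal I_{\mathcal C}$ is certificate-sound for $p$ on $\Sigma$, relative to $\mathcal C$, if for every $x\in\Sigma$ its categorical outputs ($A$ or $D$) satisfy the output contract: every $A$-output is backed by some adequate certificate in $\mathrm{trace}_x$ forcing $p(x)$, and every $D$-output by some adequate certificate in $\mathrm{trace}_x$ forcing the refutation-sound negative side and thereby establishing $\lnot p(x)$. *)

(* Defs.v *)
From mathcomp Require Import all_boot.

Set Implicit Arguments.
Unset Strict Implicit.
Unset Printing Implicit Defensive.

(* The model of computation. A procedure is a program of a small
   Turing-complete functional language over binary trees (a variable-free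
   variant of Jones's WHILE language), so that termination, decidability and
   resource use are statements about a concrete machine and not about arbitrary
   functions. [Leaf] is also the truth value false. *)

Inductive data := Leaf | Node of data & data.

Definition left_tree (d : data) := if d is Node a _ then a else Leaf.
Definition right_tree (d : data) := if d is Node _ b then b else Leaf.

Inductive prog :=
  | Id
  | Quote of data
  | Head
  | Tail
  | Pair of prog & prog
  | Chain of prog & prog
  | If of prog & prog & prog
  | While of prog & prog.

(* [run P d e n]: on input [d], [P] halts with result [e] after [n] steps. *)
Inductive run : prog -> data -> data -> nat -> Prop :=
  | RunId d : run Id d d 1
  | RunQuote c d : run (Quote c) d c 1
  | RunHead d : run Head d (left_tree d) 1
  | RunTail d : run Tail d (right_tree d) 1
  | RunPair P Q d a b m n :
      run P d a m -> run Q d b n -> run (Pair P Q) d (Node a b) (m + n).+1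
  | RunChain P Q d e f m n :
      run P d e m -> run Q e f n -> run (Chain P Q) d f (m + n).+1
  | RunIfTrue B P Q d a b e m n :
      run B d (Node a b) m -> run P d e n -> run (If B P Q) d e (m + n).+1
  | RunIfFalse B P Q d e m n :
      run B d Leaf m -> run Q d e n -> run (If B P Q) d e (m + n).+1
  | RunWhileTrue B P d a b e f m n k :
      run B d (Node a b) m -> run P d e n -> run (While B P) e f k ->
      run (While B P) d f (m + n + k).+1
  | RunWhileFalse B P d m : run B d Leaf m -> run (While B P) d d m.+1.

Definition halts (P : prog) (d e : data) := exists n, run P d e n.

Record coded := Coded {
  carrier :> eqType;
  code : carrier -> data;
  code_inj : injective code
}.

Definition code_bool (b : bool) := if b then Node Leaf Leaf else Leaf.
Definition code_seq (s : seq data) := foldr Node Leaf s.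

(* [Neg] is the contractually specified negative side of a predicate, a
   condition of its own and not the absence of [Pos]. *)
Inductive side := Pos | Neg.
Definition code_side (s : side) := code_bool (if s is Pos then true else false).

Inductive status := Asserted | Denied | Undetermined.
Definition code_status (v : status) :=
  match v with
  | Asserted => Leaf
  | Denied => Node Leaf Leaf
  | Undetermined => Node Leaf (Node Leaf Leaf)
  end.

(* The certification regime, the public standard and the times of a contract
   act only through [adequate] and [forces]. [budget] bounds execution steps,
   [horizon] bounds refinement rounds. *)
Record contract := Contract {
  input : coded;
  scope : input -> Prop;
  cert : coded;
  adequate : cert -> input -> Prop;
  forces : (input -> Prop) -> side -> cert -> input -> Prop;
  budget : nat;
  horizon : nat
}.

Definition adequate_forcing (C : contract) (p : input C -> Prop) (s : side)
    (k : cert C) (x : input C) : Prop :=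
  adequate k x /\ forces p s k x.

Definition refutation_sound (C : contract) (p : input C -> Prop) : Prop :=
  forall x, scope x -> forall k, adequate_forcing p Neg k x -> ~ p x.

Definition decidable_on_scope (C : contract) (Q : cert C -> input C -> Prop) :=
  exists P : prog, forall k x, scope x ->
    exists2 b : bool, b <-> Q k x &
      halts P (Node (code k) (code x)) (code_bool b).

Definition checks_decidable (C : contract) (p : input C -> Prop) : Prop :=
  decidable_on_scope (@adequate C) /\
  forall s, decidable_on_scope (@forces C p s).

(* A trace may hold more than certificates (checks, reasons); [certs] lists the
   certificates occurring in it. The last four fields are the programs carrying
   out the evaluation: from [ev_start], apply [ev_refine] as long as [ev_test]
   answers true, then read off the result with [ev_result]. *)
Record interface (C : contract) := Interface {
  trace : coded;
  certs : trace -> seq (cert C);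
  status_of : input C -> status;
  trace_of : input C -> trace;
  ev_start : prog;
  ev_test : prog;
  ev_refine : prog;
  ev_result : prog
}.

Definition in_trace (C : contract) (I : interface C) (k : cert C)
    (x : input C) : Prop :=
  k \in certs (trace_of I x).

Definition traces_enumerable (C : contract) (I : interface C) : Prop :=
  exists P : prog, forall x, scope x ->
    halts P (code (trace_of I x))
      (code_seq [seq code k | k <- certs (trace_of I x)]).

(* [refines B P d e r n]: the refinement loop leads from state [d] to the final
   state [e] in [r] rounds and [n] steps. *)
Inductive refines (B P : prog) : data -> data -> nat -> nat -> Prop :=
  | RefinesDone d m : run B d Leaf m -> refines B P d d 0 m
  | RefinesStep d a b d' e r m n k :
      run B d (Node a b) m -> run P d d' n -> refines B P d' e r k ->
      refines B P d e r.+1 (m + n + k).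

(* The evaluation at [x] halts with the pair of the status and the trace
   assigned to [x], in [r] refinement rounds and [n] steps overall. *)
Definition evaluates (C : contract) (I : interface C) (x : input C)
    (r n : nat) : Prop :=
  exists d e n1 n2 n3,
    [/\ run (ev_start I) (code x) d n1,
        refines (ev_test I) (ev_refine I) d e r n2,
        run (ev_result I) e
          (Node (code_status (status_of I x)) (code (trace_of I x))) n3 &
        n = n1 + n2 + n3].

Definition binary_total (C : contract) (I : interface C) : Prop :=
  forall x, scope x ->
    (exists r n, [/\ r <= horizon C, n <= budget C & evaluates I x r n]) /\
    (status_of I x = Asserted \/ status_of I x = Denied).

Definition certificate_sound (C : contract) (p : input C -> Prop)
    (I : interface C) : Prop :=
  forall x, scope x ->
    (status_of I x = Asserted ->
       exists2 k, in_trace I k x & adequate_forcing p Pos k x) /\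
    (status_of I x = Denied ->
       exists2 k, in_trace I k x & adequate_forcing p Neg k x).

(* The last clause records that the returned negative side is the negation of
   [p]; no soundness is presupposed for the positive side. *)
Definition witnessed_decision_procedure (C : contract) (p : input C -> Prop)
    (P : prog) : Prop :=
  forall x, scope x -> exists (s : side) (k : cert C),
    [/\ halts P (code x) (Node (code_side s) (code k)),
        adequate_forcing p s k x &
        s = Neg -> ~ p x].

(* Main.v *)
Require Import Defs.
From mathcomp Require Import all_boot.

Set Implicit Arguments.
Unset Strict Implicit.
Unset Printing Implicit Defensive.

(** Binary totality makes the contract-level evaluation halt with a categorical
    status and the trace; certificate soundness puts an adequate forcing
    certificate for the announced side into that trace, so an unbounded linear
    search through the enumerated trace, using the decidable checks, ends. *)

Lemma halts_quote c d : halts (Quote c) d c.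
Proof. by exists 1; constructor. Qed.

Lemma halts_id d : halts Id d d.
Proof. by exists 1; constructor. Qed.

Lemma halts_head a b : halts Head (Node a b) a.
Proof. by exists 1; apply: (RunHead (Node a b)). Qed.

Lemma halts_tail a b : halts Tail (Node a b) b.
Proof. by exists 1; apply: (RunTail (Node a b)). Qed.

Lemma halts_pair P Q d a b :
  halts P d a -> halts Q d b -> halts (Pair P Q) d (Node a b).
Proof. by move=> [m HP] [n HQ]; exists (m + n).+1; constructor. Qed.

Lemma halts_chain P Q d e f :
  halts P d e -> halts Q e f -> halts (Chain P Q) d f.
Proof. by move=> [m HP] [n HQ]; exists (m + n).+1; apply: RunChain HP HQ. Qed.

Lemma halts_if B P Q d e (b : bool) :
  halts B d (code_bool b) -> halts (if b then P else Q) d e ->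
  halts (If B P Q) d e.
Proof.
case: b => -[m HB] [n HP]; exists (m + n).+1.
  exact: RunIfTrue HB HP.
exact: RunIfFalse HB HP.
Qed.

Lemma halts_while_true B P d e f :
  halts B d (code_bool true) -> halts P d e -> halts (While B P) e f ->
  halts (While B P) d f.
Proof.
move=> [m HB] [n HP] [k HW]; exists (m + n + k).+1.
exact: RunWhileTrue HB HP HW.
Qed.

Lemma halts_while_false B P d :
  halts B d (code_bool false) -> halts (While B P) d d.
Proof. by move=> [m HB]; exists m.+1; apply: RunWhileFalse. Qed.

(** Each refinement round is one pass of the loop. The two step counts differ, since every [While]
    rule charges an extra step, so only halting is carried over. *)
Lemma refines_halts B P d e r n : refines B P d e r n -> halts (While B P) d e.
Proof.
elim=> {d e r n} [d m HB | d a b d' e r m n k HB HP _ [j HW]].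
  by exists m.+1; apply: RunWhileFalse.
by exists (m + n + j).+1; apply: RunWhileTrue HB HP HW.
Qed.

Definition eval_prog (C : contract) (I : interface C) : prog :=
  Chain (ev_start I) (Chain (While (ev_test I) (ev_refine I)) (ev_result I)).

Lemma evaluates_halts (C : contract) (I : interface C) (x : input C) r n :
  evaluates I x r n ->
  halts (eval_prog I) (code x)
    (Node (code_status (status_of I x)) (code (trace_of I x))).
Proof.
move=> [d [e [n1 [n2 [n3 [Hstart /refines_halts Hloop Hresult _]]]]]].
apply: (halts_chain (e := d)); first by exists n1.
by apply: halts_chain Hloop _; exists n3.
Qed.

(** The second check runs only if the first accepts; otherwise [Quote Leaf] answers false. *)
Lemma decidable_and (C : contract) (Q R : cert C -> input C -> Prop) :
  decidable_on_scope Q -> decidable_on_scope R ->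
  decidable_on_scope (fun k x => Q k x /\ R k x).
Proof.
move=> [P HP] [P' HP']; exists (If P P' (Quote Leaf)) => k x xS.
have [b bE Hb] := HP k x xS; have [b' bE' Hb'] := HP' k x xS.
exists (b && b').
  by split=> [/andP[/bE ? /bE' ?] | [/bE ? /bE' ?]]; [split | apply/andP].
apply: halts_if Hb _.
by case: (b); [exact: Hb' | exact: halts_quote].
Qed.

(* The loop has no test for an exhausted list, so it ends only on a list that
   contains an element accepted by [Q]. *)
Definition search (Q : prog) : prog :=
  Chain
    (While (If (Chain (Pair (Chain Head Head) Tail) Q)
               (Quote Leaf) (Quote (Node Leaf Leaf)))
           (Pair (Chain Head Tail) Tail))
    (Chain Head Head).

(** Induction on the list: some element is accepted, so the loop stops at the first such. That one
    may differ from the assumed witness, hence [A k] is stated anew. *)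
Lemma search_halts (T : eqType) (c : T -> data) (A : T -> Prop) (Q : prog)
    (y : data) :
  (forall k, exists2 b : bool, b <-> A k &
     halts Q (Node (c k) y) (code_bool b)) ->
  forall s : seq T, (exists2 k, k \in s & A k) ->
  exists2 k, A k & halts (search Q) (Node (code_seq (map c s)) y) (c k).
Proof.
move=> HQ s sA.
(* The loop stops with the accepted element in front of an unexamined rest [t]; the final
   [Chain Head Head] reads it off. *)
suff [k [t Ak Ht]] : exists k, exists2 t, A k &
    halts (While (If (Chain (Pair (Chain Head Head) Tail) Q)
                     (Quote Leaf) (Quote (Node Leaf Leaf)))
                 (Pair (Chain Head Tail) Tail))
      (Node (code_seq (map c s)) y) (Node (Node (c k) t) y).
  exists k => //; apply: halts_chain Ht _.
  by apply: halts_chain; exact: halts_head.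
elim: s sA => [[k]|k s IHs [k' k's Ak']]; first by rewrite in_nil.
have [b bE Hb] := HQ k.
(* The loop must go on while [Q] rejects, so its test negates the answer of [Q]. *)
have Htest : halts
    (If (Chain (Pair (Chain Head Head) Tail) Q)
        (Quote Leaf) (Quote (Node Leaf Leaf)))
    (Node (code_seq (map c (k :: s))) y) (code_bool (~~ b)).
  apply: (halts_if (b := b)).
    apply: halts_chain Hb; apply: halts_pair; last exact: halts_tail.
    by apply: halts_chain; exact: halts_head.
  by case: (b); exact: halts_quote.
case: b => [|] in bE Hb Htest *.
  exists k, (code_seq (map c s)); first exact/bE.
  exact: halts_while_false Htest.
(* The head was rejected, so the witness is not the head and lies in the tail. *)
have [|k1 [t Ak1 Ht]] := IHs.
  exists k' => //; move: k's; rewrite in_cons => /orP[/eqP k'k|//].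
  by move: Ak'; rewrite k'k => /bE.
exists k1, t => //; apply: halts_while_true Htest _ Ht.
apply: halts_pair; last exact: halts_tail.
by apply: halts_chain; [exact: halts_head | exact: halts_tail].
Qed.

(** Meant for a state made of the evaluation result (status and trace) paired with the input, which
    the checks still need. *)
Definition answer (enum check : prog) (s : side) : prog :=
  Pair (Quote (code_side s))
       (Chain (Pair (Chain (Chain Head Tail) enum) Tail) (search check)).

Lemma answer_halts (C : contract) (I : interface C) (enum check : prog)
    (A : cert C -> Prop) (s : side) (v : data) (x : input C) :
  halts enum (code (trace_of I x))
    (code_seq [seq code k | k <- certs (trace_of I x)]) ->
  (forall k, exists2 b : bool, b <-> A k &
     halts check (Node (code k) (code x)) (code_bool b)) ->
  (exists2 k, in_trace I k x & A k) ->
  exists2 k, A k &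
    halts (answer enum check s)
      (Node (Node v (code (trace_of I x))) (code x))
      (Node (code_side s) (code k)).
Proof.
move=> Henum Hcheck /(search_halts Hcheck)[k Ak Hk]; exists k => //.
apply: halts_pair; first exact: halts_quote.
apply: halts_chain Hk; apply: halts_pair; last exact: halts_tail.
apply: halts_chain Henum.
by apply: halts_chain; [exact: halts_head | exact: halts_tail].
Qed.

Theorem proposition1 (C : contract) (p : input C -> Prop) (I : interface C)
    (Hdec : checks_decidable p) (Henum : traces_enumerable I)
    (Hneg : refutation_sound p)
    (Htot : binary_total I) (Hcert : certificate_sound p I) :
  exists P : prog, witnessed_decision_procedure p P.
Proof.
have [Hadeq Hforces] := Hdec; have [enum HE] := Henum.
have [Qpos Hpos] := decidable_and Hadeq (Hforces Pos).
have [Qneg Hnegc] := decidable_and Hadeq (Hforces Neg).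
(* [Asserted] is coded by [Leaf], which is false as a test, so the positive search is the else
   branch. *)
exists (Chain (Pair (eval_prog I) Id)
  (If (Chain Head Head) (answer enum Qneg Neg) (answer enum Qpos Pos))).
move=> x xS.
have [[r [n [_ _ /evaluates_halts Hev]]] Hv] := Htot x xS.
have [HA HD] := Hcert x xS.
have Hstate := halts_pair Hev (halts_id (code x)).
have Hstatus : halts (Chain Head Head)
    (Node (Node (code_status (status_of I x)) (code (trace_of I x))) (code x))
    (code_status (status_of I x)).
  by apply: halts_chain; exact: halts_head.
case: Hv => Hv.
  have [k Ak Hk] := answer_halts Pos
    (code_status (status_of I x)) (HE x xS) (fun k => Hpos k x xS) (HA Hv).
  exists Pos, k; split=> //.
  apply: halts_chain Hstate _; apply: (halts_if (b := false)) Hk.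
  (* Only the output status is replaced; the state keeps the form it has in [Hk]. *)
  by move: Hstatus; rewrite {2}Hv.
have [k Ak Hk] := answer_halts Neg
  (code_status (status_of I x)) (HE x xS) (fun k => Hnegc k x xS) (HD Hv).
(* Refutation-soundness turns the certificate found into a proof of [~ p x]. *)
exists Neg, k; split=> //; last by move=> _; exact: Hneg xS _ Ak.
apply: halts_chain Hstate _; apply: (halts_if (b := true)) Hk.
by move: Hstatus; rewrite {2}Hv.
Qed.
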